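(* Let $n \ge m \ge 1$ be integers and let $\bm{Q} \in \mathbb{R}^{n \times m}$ be distributed uniformly over the set of semi-orthogonal matrices $\{ \bm{U} \in \mathbb{R}^{n \times m} : \bm{U}^\top \bm{U} = \bm{I}_m \}$. Then, for any symmetric positive semidefinite matrix $\bm{A}\in \mathbb{R}^{nm\times nm}$, $$\mathbb{E}[\operatorname{vec}(\bm{Q})^\top \bm{A} \operatorname{vec}(\bm{Q})] \ \leq \ \max_{\bm{U} \in \mathbb{R}^{n \times m}:\, \bm{U}^\top \bm{U}=\bm{I}_m} \operatorname{vec}(\bm{U})^\top \bm{A} \operatorname{vec}(\bm{U}) \ \leq \ nm \, \mathbb{E}[\operatorname{vec}(\bm{Q})^\top \bm{A} \operatorname{vec}(\bm{Q})].$$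
   Context: $\operatorname{vec}(\bm{X})\in\mathbb{R}^{nm}$ stacks the columns of $\bm{X}\in\mathbb{R}^{n\times m}$. ''Uniformly'' means according to the Haar (invariant) probability measure on the set of semi-orthogonal matrices, i.e. the unique probability measure on this set invariant under $\bm{U}\mapsto \bm{O}\bm{U}$ for every $n\times n$ orthogonal matrix $\bm{O}$ that is also invariant under $\bm{U}\mapsto\bm{U}\bm{P}$ for every $m\times m$ orthogonal matrix $\bm{P}$. *)

(* Defs.v *)
From mathcomp Require Import all_boot all_order all_algebra.
From mathcomp Require Import all_classical all_reals all_analysis.

Set Implicit Arguments.
Unset Strict Implicit.
Unset Printing Implicit Defensive.

Import Order.TTheory GRing.Theory Num.Theory.
Import numFieldNormedType.Exports.

Local Open Scope classical_set_scope.
Local Open Scope ring_scope.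

(* [mxvec] lists the entries of a matrix row by row, so applying it to the
   transpose stacks the columns of X; see [mxvec_index_val] for the position of
   the (i, j) entry.  The length is written m * n so that no cast is needed. *)
Definition vec (R : Type) (n m : nat) (X : 'M[R]_(n, m)) : 'cV[R]_(m * n) :=
  (mxvec X^T)^T.

Lemma index_allpairs (T1 T2 : eqType) (s : seq T1) (t : seq T2) (x : T1) (y : T2) :
  x \in s -> y \in t ->
  index (x, y) [seq (a, b) | a <- s, b <- t]
  = (index x s * size t + index y t)%N.
Proof.
move=> + yt; elim: s => [//|a s IHs] xas.
rewrite /= index_cat; have [->|ax] := eqVneq a x.
  by rewrite map_f// mul0n add0n index_map// => ? ? [].
rewrite ifF; last by apply/mapP => -[b _ [xa _]]; rewrite xa eqxx in ax.
move: xas; rewrite inE eq_sym (negPf ax)/= => xs.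
by rewrite size_map IHs// mulSn addnA.
Qed.

Lemma mxvec_index_val (m n : nat) (j : 'I_m) (i : 'I_n) :
  mxvec_index j i = (j * n + i)%N :> nat.
Proof.
have -> : mxvec_index j i = index (j, i) (enum {: 'I_m * 'I_n}) :> nat.
  rewrite /= -{2}(nth_enum_rank (j, i) (j, i)) index_uniq ?enum_uniq//.
  by rewrite -cardE ltn_ord.
rewrite enumT Finite.enum.unlock /= index_allpairs ?mem_enum//.
by rewrite !index_enum_ord size_enum_ord.
Qed.

Lemma vecE (R : Type) (n m : nat) (X : 'M[R]_(n, m)) (i : 'I_n) (j : 'I_m) :
  vec X (mxvec_index j i) 0 = X i j.
Proof. by rewrite /vec mxE mxvecE mxE. Qed.

Definition quad_form (R : realType) (k : nat) (A : 'M[R]_k) (x : 'cV[R]_k) : R :=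
  (x^T *m A *m x) 0 0.

Definition sym_psd (R : realType) (k : nat) (A : 'M[R]_k) : Prop :=
  A^T = A /\ forall x : 'cV[R]_k, 0 <= quad_form A x.

Definition semi_orthogonal (R : realType) (n m : nat) : set 'M[R]_(n, m) :=
  [set U | U^T *m U = 1%:M].

Definition is_max (R : realType) (S : set R) (x : R) : Prop :=
  S x /\ ubound S x.

Definition borel_mx (R : realType) (n m : nat) :=
  g_sigma_algebraType (@open 'M[R]_(n, m)).

(* A probability on the set of semi-orthogonal matrices is represented by a
   Borel probability on the ambient matrix space that gives this set mass 1. *)
Definition haar_semi_orthogonal (R : realType) (n m : nat)
    (mu : probability (borel_mx R n m) R) : Prop :=
  [/\ mu (@semi_orthogonal R n m) = 1%E,
      forall O : 'M[R]_n, semi_orthogonal O ->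
        forall B : set (borel_mx R n m), measurable B ->
          mu ((fun U : 'M[R]_(n, m) => O *m U) @^-1` B) = mu B
    & forall P : 'M[R]_m, semi_orthogonal P ->
        forall B : set (borel_mx R n m), measurable B ->
          mu ((fun U : 'M[R]_(n, m) => U *m P) @^-1` B) = mu B].

(* Main.v *)
(* Averaging over sign flips and permutations of the rows and columns gives
   [E (vec Q) (vec Q)^T = I / n], so the expectation of the quadratic form is
   [tr A / n].  For positive semidefinite A, [x^T A x <= tr A * |x|^2], and
   [|vec U|^2 = m], so the maximum is at most [m * tr A = n * m * (tr A / n)]. *)

Require Import Defs.
From mathcomp Require Import all_boot all_order all_algebra all_fingroup.
From mathcomp Require Import all_classical all_reals all_analysis.
From mathcomp Require Import measurable_realfun.
From mathcomp Require Import ring lra.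

Set Implicit Arguments.
Unset Strict Implicit.
Unset Printing Implicit Defensive.

Import Order.TTheory GRing.Theory Num.Theory.
Import numFieldNormedType.Exports.

Local Open Scope classical_set_scope.
Local Open Scope ring_scope.

(** * Quadratic forms, the trace bound, and entries of semi-orthogonal matrices *)

Lemma quad_formE (R : realType) (k : nat) (A : 'M[R]_k) (x : 'cV[R]_k) :
  quad_form A x = \sum_i \sum_j A i j * (x i 0 * x j 0).
Proof.
rewrite /quad_form mxE exchange_big; apply: eq_bigr => j _.
rewrite !mxE mulr_suml; apply: eq_bigr => i _.
by rewrite !mxE mulrAC mulrC.
Qed.

(** Symmetry merges the two cross terms. The case [i = j] is included, since the trace bound sums
    over all pairs. *)
Lemma quad_form_delta (R : realType) (k : nat) (A : 'M[R]_k) (i j : 'I_k)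
    (a b : R) :
  A^T = A ->
  quad_form A (a *: delta_mx i 0 - b *: delta_mx j 0)
  = a ^+ 2 * A i i - 2 * (a * b) * A i j + b ^+ 2 * A j j.
Proof.
move=> symA; have AE u v : A v u = A u v by rewrite -{1}symA mxE.
have bil u v : (delta_mx u 0 : 'cV[R]_k)^T *m A *m (delta_mx v 0 : 'cV[R]_k)
    = (A u v)%:M :> 'M[R]_1.
  rewrite trmx_delta -rowE -colE; apply/matrixP => r s.
  by rewrite !ord1 !mxE eqxx mulr1n.
rewrite /quad_form [_^T]linearB /= ![_^T]linearZ /= !(mulmxBl, mulmxBr).
rewrite -!(scalemxAl, scalemxAr) !bil !mxE eqxx !mulr1n (AE i j).
by ring.
Qed.

(* Testing positivity on [x_j e_i - x_i e_j] gives
   [2 x_i x_j A_ij <= x_j^2 A_ii + x_i^2 A_jj]; sum over i and j. *)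
Lemma quad_form_le_trace (R : realType) (k : nat) (A : 'M[R]_k) (x : 'cV[R]_k) :
  sym_psd A -> quad_form A x <= \tr A * \sum_i x i 0 ^+ 2.
Proof.
move=> [symA psdA].
have trE : \tr A * \sum_i x i 0 ^+ 2 = \sum_i \sum_j A i i * x j 0 ^+ 2.
  by rewrite mulr_suml; apply: eq_bigr => i _; rewrite mulr_sumr.
suff : 2 * quad_form A x <=
    \sum_i \sum_j A i i * x j 0 ^+ 2 + \sum_i \sum_j A j j * x i 0 ^+ 2.
  by rewrite [X in _ + X]exchange_big -trE; lra.
rewrite quad_formE mulr_sumr -big_split; apply: ler_sum => i _.
rewrite mulr_sumr -big_split; apply: ler_sum => j _.
have := psdA (x j 0 *: delta_mx i 0 - x i 0 *: delta_mx j 0).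
by rewrite quad_form_delta//=; lra.
Qed.

(** Applied to squaring, this splits the squared norm of [vec U] into squared column norms. *)
Lemma sum_vec (R : realType) (n m : nat) (U : 'M[R]_(n, m)) (f : R -> R) :
  \sum_k f (vec U k 0) = \sum_j \sum_i f (U i j).
Proof.
rewrite pair_big /= (reindex _ (curry_mxvec_bij _ _)) /=.
by apply: eq_bigr => -[j i] _; rewrite vecE.
Qed.

Lemma semi_orthogonal_col (R : realType) (n m : nat) (U : 'M[R]_(n, m))
    (j : 'I_m) :
  semi_orthogonal U -> \sum_i U i j ^+ 2 = 1.
Proof.
move=> /(congr1 (fun B : 'M[R]_m => B j j)); rewrite !mxE eqxx mulr1n => <-.
by apply: eq_bigr => i _; rewrite !mxE expr2.
Qed.

(** An entry is one coordinate of a unit column. The bound serves both compactness and the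
    integrability of products of entries. *)
Lemma semi_orthogonal_entry (R : realType) (n m : nat) (U : 'M[R]_(n, m))
    (i : 'I_n) (j : 'I_m) :
  semi_orthogonal U -> `|U i j| <= 1.
Proof.
move=> sU; rewrite -(@expr_le1 _ 2)// real_normK ?num_real// -(semi_orthogonal_col j sU).
rewrite (bigD1 i)//= lerDl; apply: sumr_ge0 => k _; exact: sqr_ge0.
Qed.

Lemma quad_form_semi_orthogonal (R : realType) (n m : nat)
    (A : 'M[R]_(m * n)) (U : 'M[R]_(n, m)) :
  sym_psd A -> semi_orthogonal U -> quad_form A (vec U) <= m%:R * \tr A.
Proof.
move=> psdA sU; apply: (le_trans (quad_form_le_trace _ psdA)).
rewrite (sum_vec U (fun r => r ^+ 2)) mulrC.
under eq_bigr do rewrite semi_orthogonal_col//.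
by rewrite sumr_const card_ord.
Qed.

(** * Continuity, closedness and existence of a maximizer *)

Lemma continuous_sum (R : realType) (T : topologicalType) (I : Type)
    (s : seq I) (f : I -> T -> R) :
  (forall i, continuous (f i)) -> continuous (fun x => \sum_(i <- s) f i x).
Proof.
move=> cf x; elim: s => [|i s IHs].
  under eq_fun do rewrite big_nil.
  exact: cvg_cst.
under eq_fun do rewrite big_cons.
apply: cvgD; [exact: cf|exact: IHs].
Qed.

(** A neighbourhood of a matrix contains a product of neighbourhoods of its entries, and finitely
    many conditions that each hold near [x] hold jointly near [x]. *)
Lemma continuous_mx (R : realType) (T : topologicalType) (n m : nat)
    (f : T -> 'M[R]_(n, m)) :
  (forall i j, continuous (fun x => f x i j)) -> continuous f.
Proof.
move=> cf x B [P nP PB].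
have : \forall y \near x, forall ij : 'I_n * 'I_m, P ij.1 ij.2 (f y ij.1 ij.2).
  by apply: filter_forall => -[i j]; apply: cf; exact: nP.
by apply: filterS => y Py; apply: PB => i j; exact: (Py (i, j)).
Qed.

Lemma continuous_entryM (R : realType) (n m : nat) (i i' : 'I_n) (j j' : 'I_m) :
  continuous (fun U : 'M[R]_(n, m) => U i j * U i' j').
Proof. by move=> U; apply: continuousM; apply: coord_continuous. Qed.

Lemma continuous_quad_form_vec (R : realType) (n m : nat) (A : 'M[R]_(m * n)) :
  continuous (fun U : 'M[R]_(n, m) => quad_form A (vec U)).
Proof.
under eq_fun do rewrite quad_formE.
apply: continuous_sum => k; apply: continuous_sum => l.
pose v (U : 'M[R]_(n, m)) := vec U k 0 * vec U l 0.
have cv : continuous v.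
  rewrite /v {v}.
  case/mxvec_indexP: k => j i; case/mxvec_indexP: l => j' i'.
  under eq_fun do rewrite !vecE.
  exact: continuous_entryM.
move=> U.
by apply: (@continuousM _ _ (fun=> A k l) v); [exact: cst_continuous|exact: cv].
Qed.

Lemma continuous_mulmxl (R : realType) (n m k : nat) (O : 'M[R]_(k, n)) :
  continuous (fun U : 'M[R]_(n, m) => O *m U).
Proof.
apply: continuous_mx => i j; under eq_fun do rewrite mxE.
apply: continuous_sum => l U.
by apply: continuousM; [exact: cst_continuous|exact: coord_continuous].
Qed.

Lemma continuous_mulmxr (R : realType) (n m k : nat) (P : 'M[R]_(m, k)) :
  continuous (fun U : 'M[R]_(n, m) => U *m P).
Proof.
apply: continuous_mx => i j; under eq_fun do rewrite mxE.
apply: continuous_sum => l U.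
by apply: continuousM; [exact: coord_continuous|exact: cst_continuous].
Qed.

Lemma closed_semi_orthogonal (R : realType) (n m : nat) :
  closed (@semi_orthogonal R n m).
Proof.
(* One closed condition per pair of columns: their inner product, continuous in [U], takes the
   prescribed value 0 or 1. *)
rewrite (_ : @semi_orthogonal R n m = \bigcap_(jk in [set: 'I_m * 'I_m])
    ((fun U : 'M[R]_(n, m) => \sum_i U i jk.1 * U i jk.2)
       @^-1` [set (jk.1 == jk.2)%:R])).
  apply: closed_bigI => jk _.
  apply: preimage_closed; last exact: closed_eq.
  move=> U _; apply: continuous_sum => i; exact: continuous_entryM.
apply/seteqP; split=> [U sU [j k] _ /=|U sU].
  have /(congr1 (fun B : 'M[R]_m => B j k)) := sU; rewrite !mxE => <-.
  by apply: eq_bigr => i _; rewrite !mxE.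
apply/matrixP => j k; rewrite !mxE -(sU (j, k) Logic.I).
by apply: eq_bigr => i _; rewrite !mxE.
Qed.

(* Compactness is only available for row vectors, hence the detour through
   [mxvec]. *)
Lemma semi_orthogonal_EVT_max (R : realType) (n m : nat)
    (f : 'M[R]_(n, m) -> R) :
  @semi_orthogonal R n m !=set0 -> continuous f ->
  exists2 U, semi_orthogonal U & forall V, semi_orthogonal V -> f V <= f U.
Proof.
move=> [U0 sU0] cf.
have cvecmx : continuous (@vec_mx R n m).
  apply: continuous_mx => i j; under eq_fun do rewrite mxE.
  exact: coord_continuous.
pose S := vec_mx @^-1` @semi_orthogonal R n m.
have S0 : S !=set0 by exists (mxvec U0); rewrite /S /= mxvecK.
have cS : compact S.
  apply: bounded_closed_compact.
    exists 1; split; first exact: num_real.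
    move=> r r1 v Sv; apply: le_trans (ltW r1).
    rewrite [leLHS]/Num.norm /= mx_normrE; apply: bigmax_le => // -[i k] _ /=.
    rewrite ord1; case/mxvec_indexP: k => {}i j.
    by have := semi_orthogonal_entry i j Sv; rewrite mxE.
  by apply: preimage_closed => [v _|];
    [exact: cvecmx|exact: closed_semi_orthogonal].
have cg : {within S, continuous (f \o vec_mx)}.
  apply: continuous_subspaceT => v.
  by apply: continuous_comp; [exact: cvecmx|exact: cf].
have [v Sv vmax] := compact_EVT_max S0 cS cg.
exists (vec_mx v); first by move: Sv; rewrite inE.
by move=> V sV; have := vmax (mxvec V); rewrite /= mxvecK; apply;
  rewrite inE /S /= mxvecK.
Qed.

(** * Borel measurability, and integration against a probability carried by a set *)

Lemma measurable_continuous_fun (R : realType) (n m : nat)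
    (f : 'M[R]_(n, m) -> R) :
  continuous f -> measurable_fun [set: borel_mx R n m] (f : borel_mx R n m -> R).
Proof.
(* Open intervals generate the Borel sets of the line, so only their preimages have to be
   checked. *)
move=> /continuousP cf; apply: (measurability _ (RGenOpens.measurableE R)).
move=> _ [_ [a [b ->]] <-]; rewrite setTI; apply: sub_sigma_algebra.
by apply: cf; exact: interval_open.
Qed.

Lemma measurable_continuous_mx (R : realType) (n m n' m' : nat)
    (phi : 'M[R]_(n, m) -> 'M[R]_(n', m')) :
  continuous phi ->
  measurable_fun [set: borel_mx R n m] (phi : borel_mx R n m -> borel_mx R n' m').
Proof.
move=> /continuousP cphi.
apply: (@measurability _ _ (borel_mx R n m) (borel_mx R n' m') _ _
  (@open 'M[R]_(n', m'))) => //.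
move=> _ [B oB <-]; rewrite setTI; apply: sub_sigma_algebra.
exact: cphi.
Qed.

Lemma measurable_semi_orthogonal (R : realType) (n m : nat) :
  measurable (@semi_orthogonal R n m : set (borel_mx R n m)).
Proof.
rewrite -[X in measurable X]setCK; apply: measurableC.
apply: sub_sigma_algebra; rewrite openC; exact: closed_semi_orthogonal.
Qed.

(** The complement of [D] is null. This lets identities valid only for semi-orthogonal matrices be
    used under integrals over the whole matrix space. *)
Lemma integral_full_measure (R : realType) (d : measure_display)
    (T : measurableType d) (P : probability T R) (D : set T) (f : T -> \bar R) :
  measurable D -> P D = 1%E -> P.-integrable setT f ->
  (\int[P]_x f x = \int[P]_(x in D) f x)%E.
Proof.
move=> mD PD intf.
have PND : P (~` D) = 0%E by rewrite probability_setC// PD subee.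
rewrite (@negligible_integral _ _ _ _ _ (~` D)) ?setDE ?setCK ?setTI//.
exact: measurableC.
Qed.

(** A bounded measurable function is integrable on a set of finite measure, and the null complement
    of [D] does not affect integrability. *)
Lemma integrable_full_measure (R : realType) (d : measure_display)
    (T : measurableType d) (P : probability T R) (D : set T) (f : T -> R)
    (c : R) :
  measurable D -> P D = 1%E -> measurable_fun setT f ->
  (forall x, D x -> `|f x| <= c) -> P.-integrable setT (EFin \o f).
Proof.
move=> mD PD mf fc.
have PND : P (~` D) = 0%E by rewrite probability_setC// PD subee.
have PDy : (P D < +oo)%E by rewrite PD ltry.
apply/(@negligible_integrable _ _ _ _ _ (~` D)) => //.
- exact: measurableC.
- exact/measurable_EFinP.
rewrite setDE setCK setTI; apply: measurable_bounded_integrable => //.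
- exact: measurable_funTS.
- exists c; split; first exact: num_real.
  by move=> r cr x Dx; apply: le_trans (fc x Dx) (ltW cr).
Qed.

Lemma integral_le_full_measure (R : realType) (d : measure_display)
    (T : measurableType d) (P : probability T R) (D : set T) (f : T -> R)
    (c : R) :
  measurable D -> P D = 1%E -> P.-integrable setT (EFin \o f) ->
  (forall x, D x -> f x <= c) -> (\int[P]_x (f x)%:E <= c%:E)%E.
Proof.
move=> mD PD intf fc; rewrite (integral_full_measure mD PD intf).
have -> : c%:E = (\int[P]_(x in D) (cst c%:E x))%E.
  by rewrite integral_cst// [X in (_ * X)%E](_ : _ = 1%E) ?mule1.
apply: le_integral => //.
- exact: integrableS intf.
- by apply/finite_measure_integrable_cst.
- by move=> x; rewrite inE lee_fin; exact: fc.
Qed.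

(** Invariance says that the pushforward of [mu] by [phi] is [mu] itself, so this is the change of
    variables formula. *)
Lemma integral_invariant (R : realType) (d : measure_display)
    (T : measurableType d) (mu : {measure set T -> \bar R}) (phi : T -> T)
    (f : T -> \bar R) :
  measurable_fun [set: T] phi ->
  (forall B, measurable B -> mu (phi @^-1` B) = mu B) ->
  measurable_fun [set: T] f -> mu.-integrable setT (f \o phi) ->
  (\int[mu]_x f x = \int[mu]_x f (phi x))%E.
Proof.
move=> mphi inv mf intf.
rewrite -(@integral_pushforward _ _ _ _ _ _ mphi mu setT f)//.
by apply: eq_measure_integral => B mB _; exact/esym/inv.
Qed.

(** By invariance the integral equals its own negative, and integrability makes it finite, so it
    vanishes. *)
Lemma integral_odd (R : realType) (d : measure_display)
    (T : measurableType d) (mu : {measure set T -> \bar R}) (phi : T -> T)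
    (f : T -> R) :
  measurable_fun [set: T] phi ->
  (forall B, measurable B -> mu (phi @^-1` B) = mu B) ->
  mu.-integrable setT (EFin \o f) -> (forall x, f (phi x) = - f x) ->
  (\int[mu]_x (f x)%:E = 0)%E.
Proof.
move=> mphi inv intf odd.
have ffin : (\int[mu]_x (f x)%:E)%E \is a fin_num by exact: integrable_fin_num.
have foddE x : (f (phi x))%:E = ((-1)%:E * (f x)%:E)%E.
  by rewrite odd -EFinM mulN1r.
have : (\int[mu]_x (f x)%:E = (-1)%:E * \int[mu]_x (f x)%:E)%E.
  rewrite -integralZl//; under [RHS]eq_integral do rewrite -foddE.
  apply: (integral_invariant mphi inv (measurable_int mu intf)).
  apply: eq_integrable (integrableZl _ (-1) intf) => //.
  by move=> x _; rewrite /= foddE.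
rewrite -(fineK ffin) -EFinM => -[]; rewrite mulN1r => fE.
by congr EFin; lra.
Qed.

(** * Second moments of the entries under the Haar measure *)

(** The reflection reversing the [i]-th coordinate: multiplying by it on the left negates row [i],
    on the right column [i]. *)
Definition flip_mx (R : realType) (n : nat) (i : 'I_n) : 'M[R]_n :=
  diag_mx (\row_k (-1) ^+ (k == i)).

Lemma semi_orthogonal_flip (R : realType) (n : nat) (i : 'I_n) :
  semi_orthogonal (flip_mx R i).
Proof.
rewrite /semi_orthogonal /= /flip_mx tr_diag_mx mulmx_diag.
rewrite -[RHS]diag_const_mx; congr diag_mx; apply/rowP => k.
by rewrite !mxE; case: eqP => _; rewrite ?expr1 ?expr0 ?mulrNN mulr1.
Qed.

Lemma semi_orthogonal_perm (R : realType) (n : nat) (s : 'S_n) :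
  semi_orthogonal (perm_mx s : 'M[R]_n).
Proof.
by rewrite /semi_orthogonal /= tr_perm_mx -perm_mxM mulVg perm_mx1.
Qed.

Lemma haar_integrable (R : realType) (n m : nat)
    (mu : probability (borel_mx R n m) R) (f : 'M[R]_(n, m) -> R) (c : R) :
  haar_semi_orthogonal mu ->
  continuous f -> (forall U, semi_orthogonal U -> `|f U| <= c) ->
  mu.-integrable [set: borel_mx R n m] (EFin \o f).
Proof.
move=> haar cf fc; have [mu1 _ _] := haar.
apply: (integrable_full_measure _ mu1 _ fc).
- exact: measurable_semi_orthogonal.
- exact: measurable_continuous_fun.
Qed.

Lemma haar_integrable_entryM (R : realType) (n m : nat)
    (mu : probability (borel_mx R n m) R) (i i' : 'I_n) (j j' : 'I_m) :
  haar_semi_orthogonal mu ->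
  mu.-integrable [set: borel_mx R n m]
    (EFin \o (fun U : 'M[R]_(n, m) => U i j * U i' j')).
Proof.
move=> haar.
apply: (haar_integrable haar (c := 1)); first exact: continuous_entryM.
move=> U sU; rewrite normrM mulr_ile1//; exact: semi_orthogonal_entry.
Qed.

(** Negating row [i] changes the sign of the first factor and fixes the second, which lies in
    another row; the product is odd under a symmetry of [mu]. *)
Lemma haar_entryM_row (R : realType) (n m : nat)
    (mu : probability (borel_mx R n m) R) (i i' : 'I_n) (j j' : 'I_m) :
  haar_semi_orthogonal mu -> i != i' ->
  (\int[mu]_U
    ((U : 'M[R]_(n, m)) i j * (U : 'M[R]_(n, m)) i' j')%:E = 0)%E.
Proof.
move=> haar ii'; have [_ invl _] := haar.
apply: (integral_odd (phi := fun U : borel_mx R n m => flip_mx R i *m U)).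
- exact: measurable_continuous_mx (@continuous_mulmxl _ _ _ _ _).
- exact: invl (semi_orthogonal_flip _ _).
- exact: haar_integrable_entryM.
move=> U; rewrite !mul_diag_mx !mxE eqxx eq_sym (negPf ii') expr1 expr0.
by rewrite mulN1r mul1r mulNr.
Qed.

(** Same parity argument, with column [j] negated by right multiplication. *)
Lemma haar_entryM_col (R : realType) (n m : nat)
    (mu : probability (borel_mx R n m) R) (i i' : 'I_n) (j j' : 'I_m) :
  haar_semi_orthogonal mu -> j != j' ->
  (\int[mu]_U
    ((U : 'M[R]_(n, m)) i j * (U : 'M[R]_(n, m)) i' j')%:E = 0)%E.
Proof.
move=> haar jj'; have [_ _ invr] := haar.
apply: (integral_odd (phi := fun U : borel_mx R n m => U *m flip_mx R j)).
- exact: measurable_continuous_mx (@continuous_mulmxr _ _ _ _ _).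
- exact: invr (semi_orthogonal_flip _ _).
- exact: haar_integrable_entryM.
move=> U; rewrite !mul_mx_diag !mxE eqxx eq_sym (negPf jj') expr1 expr0.
by rewrite mulrN1 mulr1 mulNr.
Qed.

(** Row swaps give the [n] entries of column [j] the same second moment, and their squares sum to 1
    almost surely. *)
Lemma haar_entry_sqr (R : realType) (n m : nat)
    (mu : probability (borel_mx R n m) R) (i : 'I_n) (j : 'I_m) :
  haar_semi_orthogonal mu ->
  (\int[mu]_U
    ((U : 'M[R]_(n, m)) i j * (U : 'M[R]_(n, m)) i j)%:E = n%:R^-1%:E)%E.
Proof.
move=> haar; have [mu1 invl _] := haar.
pose f k (U : borel_mx R n m) := ((U : 'M[R]_(n, m)) k j * U k j)%:E.
have intf k : mu.-integrable setT (f k) by exact: haar_integrable_entryM.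
have ffin k : (\int[mu]_U f k U)%E \is a fin_num by exact: integrable_fin_num.
have fE k : (\int[mu]_U f k U = \int[mu]_U f i U)%E.
  (* Swapping rows [i] and [k] puts [U k j] at position [(i, j)]. *)
  rewrite [RHS](integral_invariant (mu := mu)
      (phi := fun U : borel_mx R n m => perm_mx (tperm i k) *m U)).
  - by apply: eq_integral => U _; rewrite /f -row_permE !mxE tpermL.
  - exact: measurable_continuous_mx (@continuous_mulmxl _ _ _ _ _).
  - exact: invl (semi_orthogonal_perm _ _).
  - exact: measurable_int (intf i).
  - apply: eq_integrable (intf k) => // U _.
    by rewrite /f /= -row_permE !mxE tpermL.
have sumf : (\int[mu]_U (\sum_(k < n) f k U) = 1)%E.
  rewrite (integral_full_measure (@measurable_semi_orthogonal _ _ _) mu1).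
    transitivity (\int[mu]_(U in @semi_orthogonal R n m) (cst 1 U))%E.
      apply: eq_integral => U; rewrite inE => sU.
      rewrite /f sumEFin -(semi_orthogonal_col j sU).
      by congr EFin; apply: eq_bigr => k _; rewrite expr2.
    rewrite integral_cst ?mul1e//; exact: measurable_semi_orthogonal.
  exact: integrable_sum.
move: sumf; rewrite integral_sum//.
under eq_bigr do rewrite fE -(fineK (ffin i)).
rewrite sumEFin sumr_const card_ord -(fineK (ffin i)) => -[] nf1.
(* The index [i : 'I_n] itself witnesses that [n] is positive. *)
have n0 : n%:R != 0 :> R by rewrite pnatr_eq0 -lt0n (leq_ltn_trans _ (ltn_ord i)).
by congr EFin; apply: (mulfI n0); rewrite mulfV// mulr_natl.
Qed.

(** Distinct positions differ in their row or in their column, and either difference makes the mixed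
    moment vanish by a sign flip. *)
Lemma haar_vecM (R : realType) (n m : nat)
    (mu : probability (borel_mx R n m) R) (k l : 'I_(m * n)) :
  haar_semi_orthogonal mu ->
  (\int[mu]_U
    (vec (U : 'M[R]_(n, m)) k 0 * vec (U : 'M[R]_(n, m)) l 0)%:E
    = ((k == l)%:R / n%:R)%:E)%E.
Proof.
move=> haar; case/mxvec_indexP: k => j i; case/mxvec_indexP: l => j' i'.
under eq_integral do rewrite !vecE.
have [[-> ->]|ne] := eqVneq (j, i) (j', i').
  by rewrite eqxx mul1r haar_entry_sqr.
have -> : (mxvec_index j i == mxvec_index j' i') = false.
  (* Distinct index pairs have distinct positions in [vec], because [mxvec_index] is injective on
     pairs. *)
  apply/negbTE; apply: contraNneq ne => ji.
  have [g gK _] := curry_mxvec_bij m n.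
  by apply/eqP; rewrite -(gK (j, i))// -(gK (j', i'))//= ji.
rewrite mul0r; have [ii'|] := eqVneq i i'; last exact: haar_entryM_row.
have [jj'|] := eqVneq j j'; last exact: haar_entryM_col.
by rewrite ii' jj' eqxx in ne.
Qed.

Lemma haar_quad_form (R : realType) (n m : nat)
    (mu : probability (borel_mx R n m) R) (A : 'M[R]_(m * n)) :
  haar_semi_orthogonal mu ->
  (\int[mu]_U
    (quad_form A (vec (U : 'M[R]_(n, m))))%:E = (\tr A / n%:R)%:E)%E.
Proof.
move=> haar.
pose v k l (U : borel_mx R n m) :=
  (vec (U : 'M[R]_(n, m)) k 0 * vec (U : 'M[R]_(n, m)) l 0)%:E.
have intv k l : mu.-integrable setT (v k l).
  rewrite /v; case/mxvec_indexP: k => j i; case/mxvec_indexP: l => j' i'.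
  under eq_fun do rewrite !vecE.
  exact: haar_integrable_entryM.
transitivity (\int[mu]_U \sum_k \sum_l ((A k l)%:E * v k l U))%E.
  apply: eq_integral => U _; rewrite quad_formE -sumEFin.
  apply: eq_bigr => k _; rewrite -sumEFin.
  by apply: eq_bigr => l _; rewrite EFinM.
have intAv k l : mu.-integrable setT (fun U => (A k l)%:E * v k l U)%E.
  exact: integrableZl.
rewrite integral_sum//; last by move=> k; exact: integrable_sum.
rewrite mulr_suml -sumEFin; apply: eq_bigr => k _.
(* Only the diagonal term [l = k] survives, contributing [A k k / n]. *)
rewrite integral_sum// (bigD1 k)//= big1 ?adde0.
  by rewrite integralZl// haar_vecM// eqxx mul1r -EFinM.
by move=> l lk; rewrite integralZl// haar_vecM// eq_sym (negPf lk) mul0r mule0.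
Qed.

(** * Comparison of the mean with the maximum *)

Theorem proposition9 (R : realType) (n m : nat) (hm : (1 <= m)%N)
    (hmn : (m <= n)%N)
    (d : measure_display) (Omega : measurableType d) (P : probability Omega R)
    (Q : {RV P >-> borel_mx R n m})
    (hQ : haar_semi_orthogonal (distribution P Q))
    (A : 'M[R]_(m * n)) (hA : sym_psd A) :
  exists M : R,
    [/\ is_max [set quad_form A (vec U) | U in @semi_orthogonal R n m] M,
        ('E_P[fun w => quad_form A (vec (Q w))] <= M%:E)%E
      & (M%:E <= (n * m)%:R%:E * 'E_P[fun w => quad_form A (vec (Q w))])%E].
Proof.
pose f (U : 'M[R]_(n, m)) := quad_form A (vec U).
have cf : continuous f by exact: continuous_quad_form_vec.
have [mu1 _ _] := hQ.
(* The law of [Q] gives this set mass 1, so it cannot be empty. *)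
have S0 : @semi_orthogonal R n m !=set0.
  apply/set0P/eqP => S0; move: mu1; rewrite S0 measure0.
  by move=> [] /esym/eqP; rewrite oner_eq0.
have [U sU maxU] := semi_orthogonal_EVT_max S0 cf.
have mf : measurable_fun [set: borel_mx R n m] f.
  exact: measurable_continuous_fun.
(* Positivity of [A] removes the absolute value, so the maximum itself serves as the bound for
   integrability. *)
have f_le V : semi_orthogonal V -> `|f V| <= f U.
  by move=> sV; rewrite ger0_norm ?maxU//; exact: hA.2.
have EQ : ('E_P[fun w => f (Q w)] = (\tr A / n%:R)%:E)%E.
  rewrite unlock -(haar_quad_form A hQ).
  rewrite (integral_distribution (f := fun V : borel_mx R n m => (f V)%:E))//.
    exact/measurable_EFinP.
  (* Moving the expectation to the law of [Q] requires integrability on [Omega]; there the bound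
     holds on the event that [Q] is semi-orthogonal, which has probability 1. *)
  apply: (integrable_full_measure (f := f \o Q)
    (D := Q @^-1` @semi_orthogonal R n m) _ mu1 _ (fun w => f_le (Q w))).
    rewrite -[X in measurable X]setTI.
    by apply: measurable_funPT => //; exact: measurable_semi_orthogonal.
  exact: measurableT_comp.
exists (f U); split.
- by split; [exists U|move=> _ [V sV <-]; exact: maxU].
- rewrite EQ -(haar_quad_form A hQ).
  apply: (integral_le_full_measure _ mu1 _ maxU).
    exact: measurable_semi_orthogonal.
  exact: (haar_integrable hQ cf f_le).
have n0 : n%:R != 0 :> R by rewrite pnatr_eq0 -lt0n (leq_trans hm hmn).
rewrite EQ -EFinM lee_fin natrM.
(* The factor [n] cancels the [1 / n] of the mean, leaving the trace bound on the set. *)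
have -> : n%:R * m%:R * (\tr A / n%:R) = m%:R * \tr A.
  by rewrite -mulrA mulrC -!mulrA mulVf// mulr1.
exact: quad_form_semi_orthogonal.
Qed.
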